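(* Let $G$ be a bipartite graph with boundary embedded in a disc, such that all of the boundary vertices are white. Let there be $N+k$ black vertices $b_1, b_2, \dots, b_{N+k}$, let there be $N$ internal white vertices $w_1, w_2, \dots, w_N$, and let there be $n$ boundary vertices $w_{N+1}, \dots, w_{N+n}$, with that circular order. Then there is a $k\times n$ real matrix $L$ with the following property: for any $k$-element subset $I$ of $\partial G$, let $L_I$ be the submatrix of $L$ using all rows and the columns indexed by $I$. Then $\mathbb{D}(G,I) = \det L_I$.
   Context: Graphs are finite. A bipartite graph has its vertices coloured black and white so that every edge joins a black vertex to a white vertex. A graph with boundary is a finite graph $G$ with a specified subset $\partial G$ of its vertices, equipped with a circular ordering. The vertices in $\partial G$ are the boundary vertices; the other vertices of $G$ are the internal vertices. A graph with boundary is embedded in a disc if $G$ is embedded in a closed planar disc $D$ such that the vertices of $\partial G$ lie on the boundary $\partial D$ of the disc, in their specified order. A perfect matching of a graph with boundary $G$ is a collection $M$ of edges of $G$ which contains each internal vertex precisely once and each boundary vertex at most once (that is, each internal vertex lies in exactly one edge of $M$ and each boundary vertex in at most one edge of $M$). For such $M$, $\partial M$ denotes the set of boundary vertices contained in $M$, i.e. lying in edges of $M$. For a subset $I$ of $\partial G$, $\mathbb{D}(G,I)$ denotes the number of perfect matchings $M$ of $G$ with $\partial M = I$. The columns of $L$ are indexed by the boundary vertices, with $w_{N+j}$ corresponding to column $j$; columns of submatrices are kept in the order they have in $L$.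
   Formalization: The formal theorem assumes k ≥ 1; for k = 0 the claim fails, e.g. for a 4-cycle of internal vertices D(G,∅) = 2 while the determinant of the empty matrix is 1. *)

(* Defs.v *)
From mathcomp Require Import all_boot all_order all_algebra.
From mathcomp Require Import all_classical all_reals all_analysis.

Set Implicit Arguments.
Unset Strict Implicit.
Unset Printing Implicit Defensive.

Import Order.TTheory GRing.Theory Num.Theory.
Import numFieldNormedType.Exports.

Local Open Scope set_scope.

(* Parallel edges are allowed.  The circular ordering of the n boundary
   vertices is given by a listing of them, of which only the class up to
   rotation matters: [disc_embedding] below does not see where it starts. *)
Record bdgraph (n : nat) := BdGraph {
  vertex : finType;
  edge : finType;
  ends : edge -> {set vertex};
  card_ends : forall e, #|ends e| = 2;
  bdvertex : 'I_n -> vertex;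
  bdvertex_inj : injective bdvertex
}.

Definition boundary n (G : bdgraph n) : {set vertex G} :=
  [set bdvertex G j | j : 'I_n].

Definition bipartition n (G : bdgraph n) (black : {set vertex G}) : Prop :=
  forall e : edge G, exists b w : vertex G,
    [/\ b \in black, w \notin black & ends e = [set b; w]].

Definition mdegree n (G : bdgraph n) (M : {set edge G}) (v : vertex G) : nat :=
  #|[set e in M | v \in ends e]|.

Definition perfect_matching n (G : bdgraph n) (M : {set edge G}) : bool :=
  [forall v, if v \in boundary G then mdegree M v <= 1 else mdegree M v == 1].

Definition matching_boundary n (G : bdgraph n) (M : {set edge G}) :
    {set vertex G} :=
  [set v in boundary G | [exists e in M, v \in ends e]].

Definition num_matchings n (G : bdgraph n) (I : {set vertex G}) : nat :=
  #|[set M : {set edge G} | perfect_matching M & matching_boundary M == I]|.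

Definition bdindices n (G : bdgraph n) (I : {set vertex G}) : {set 'I_n} :=
  [set j | bdvertex G j \in I].

Lemma card_bdindices n (G : bdgraph n) (I : {set vertex G}) :
  I \subset boundary G -> #|bdindices I| = #|I|.
Proof.
move=> sI; rewrite -(card_imset _ (@bdvertex_inj _ G)).
apply: eq_card => v; apply/imsetP/idP => [[j]|vI].
  by rewrite inE => jI ->.
have /imsetP[j _ def_v] := fintype.subsetP sI v vI.
by exists j; rewrite // inE -def_v.
Qed.

Local Open Scope ring_scope.

(* [enum_val] lists a set of ordinals in increasing order, so the columns keep
   the order they have in L. *)
Definition column_submx (R : Type) n (G : bdgraph n) k (L : 'M[R]_(k, n))
    (I : {set vertex G}) (sI : I \subset boundary G) (cI : #|I| = k) :
    'M[R]_k :=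
  colsub (fun j : 'I_k =>
    enum_val (cast_ord (esym (etrans (card_bdindices sI) cI)) j)) L.

Definition in_disc (R : realType) (c : R * R) (r : R) (p : R * R) : Prop :=
  (p.1 - c.1) ^+ 2 + (p.2 - c.2) ^+ 2 <= r ^+ 2.

(* The points p 0, ..., p (n-1) are distinct points of the circle of centre c
   and radius r, met in that circular order in one of the two directions. *)
Definition circularly_ordered (R : realType) (c : R * R) (r : R) n
    (p : 'I_n -> R * R) : Prop :=
  exists theta : 'I_n -> R,
    [/\ forall j, p j = (c.1 + r * cos (theta j), c.2 + r * sin (theta j)),
        forall i j, `|theta i - theta j| < 2 * pi
      & (forall i j : 'I_n, (i < j)%N -> theta i < theta j) \/
        (forall i j : 'I_n, (i < j)%N -> theta j < theta i)].

(* Each edge e is drawn as the simple arc which is the image of [0, 1] under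
   [arc e]; values of [arc e] outside [0, 1] are irrelevant. *)
Record disc_embedding (R : realType) n (G : bdgraph n) := DiscEmbedding {
  center : R * R;
  radius : R;
  radius_gt0 : 0 < radius;
  pos : vertex G -> R * R;
  arc : edge G -> R -> R * R;
  pos_inj : injective pos;
  arc_continuous : forall e, {within `[0, 1], continuous (arc e)}%classic;
  arc_inj : forall e, {in `[0, 1] &, injective (arc e)};
  arc_ends : forall e, exists u v,
    [/\ ends e = [set u; v]%SET, arc e 0 = pos u & arc e 1 = pos v];
  arc_vertex : forall e v, {in `[0, 1], forall s,
    arc e s = pos v -> v \in ends e};
  arc_arc : forall e f, e != f -> {in `[0, 1] &, forall s t,
    arc e s = arc f t -> exists v, arc e s = pos v};
  pos_in_disc : forall v, in_disc center radius (pos v);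
  arc_in_disc : forall e, {in `[0, 1], forall s,
    in_disc center radius (arc e s)};
  pos_boundary :
    circularly_ordered center radius (fun j => pos (bdvertex G j))
}.

(* Main.v *)
Require Import Defs.
From mathcomp Require Import all_boot all_order all_algebra.
From mathcomp Require Import all_fingroup.
From mathcomp Require Import all_classical all_reals all_analysis.
From mathcomp Require Import ring lra zify.

Set Implicit Arguments.
Unset Strict Implicit.
Unset Printing Implicit Defensive.

Import Order.TTheory GRing.Theory Num.Theory.
Import numFieldNormedType.Exports.

Local Open Scope ring_scope.

Local Notation "\xor_ ( i < n ) F" := (\big[addb/false]_(i < n) F)
  (at level 41, F at level 41, i, n at level 50, format "\xor_ ( i < n )  F").
Local Notation "\xor_ ( i < n | P ) F" := (\big[addb/false]_(i < n | P) F)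
  (at level 41, F at level 41, i, n at level 50,
   format "\xor_ ( i < n  |  P )  F").

(** A matching M with boundary I pairs the black vertices with the internal
    white vertices and I, hence is a term in the expansion of a determinant
    whose columns are the internal white vertices followed by I in index
    order. If each entry of the biadjacency matrix carries a suitable sign,
    all matchings with the same boundary contribute equally, up to a factor
    which is the same for all I. So the sign of the permutation of M has to be
    shown to be a product of factors attached to the edges of M, factors
    attached to the vertices of I, and a constant ([labelling_sign]).

    The reason is a winding argument. For two disjoint arcs e and f the vector
    e(s) - f(t) vanishes nowhere on the unit square, so its total rotation
    along the border of the square is zero. The four sides of the square show
    e seen from the two ends of f, and f seen from the two ends of e. Rotation
    is recorded modulo 2 as the number of crossings of the leftward horizontal
    ray ([turn]); exchanging observer and observed reverses the vector, which
    costs a correction that only depends on which ends lie below which others.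
    This is [turn_exchange], where arcs are replaced by their traces on a
    mesh, so that the only topology required is that arcs are uniformly
    continuous and that disjoint arcs are at positive distance.

    Now sum this identity over all pairs of edges of M. On one side each edge
    e collects its turning numbers around all the vertices covered by M and
    not on e. Every internal vertex is covered, so the internal vertices
    contribute a number which depends on e alone; this is where M being
    perfect is used. On the other side stand the inversions of M for the order
    of the vertices by height, plus terms that split over the edges
    ([matching_sign]).

    Boundary vertices are treated separately, as only those of I are covered.
    The disc lies in a half plane bounded by the tangent at a boundary vertex
    x, so that the turning of e around x only depends on the ends of e
    ([turn_half_plane]). Moving it to the other side of the identity replaces
    the order by height with a tournament h, and on the boundary vertices h
    agrees with their circular order up to one bit per vertex
    ([circularly_ordered_swap], [planar_sign_data]). In a sum over the pairs
    in I one bit per vertex is counted k - 1 times, so it is a factor attached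
    to the vertices of I ([xor_increasing_pairs]).

    This gives a signed matrix with N + k rows whose maximal minors that
    contain the first N columns are, up to a common sign, the numbers of
    matchings ([det_columns]). Row operations bring these N columns into rank
    normal form, and the last k rows of the other columns are then the matrix L
    up to a scalar, which a row of L absorbs because k is positive
    ([det_column_reduction]). *)

(** * Crossings of a ray modulo 2 *)

Lemma xor_telescope n (u : nat -> bool) :
  \xor_(i < n) (u i (+) u i.+1) = u 0 (+) u n.
Proof.
elim: n => [|n IHn]; first by rewrite big_ord0 addbb.
by rewrite big_ord_recr /= IHn; case: (u 0); case: (u n); case: (u n.+1).
Qed.

(** Each inner edge of the grid borders two cells, so it cancels when the
    relations of all the cells are added. *)
Lemma xor_grid_boundary m n (h v : nat -> nat -> bool) :
    (forall i j, (i < m)%N -> (j < n)%N ->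
      h i j (+) h i j.+1 (+) v i j (+) v i.+1 j = false) ->
  (\xor_(i < m) h i 0%N) (+) (\xor_(i < m) h i n) =
  (\xor_(j < n) v 0%N j) (+) (\xor_(j < n) v m j).
Proof.
move=> cell.
have row i : (i < m)%N ->
    h i 0%N (+) h i n = (\xor_(j < n) v i j) (+) (\xor_(j < n) v i.+1 j).
  move=> lt_im; rewrite -(xor_telescope n (h i)) -big_split /=.
  apply: eq_bigr => j _; have := cell i j lt_im (ltn_ord j).
  by case: (h i j); case: (h i j.+1); case: (v i j); case: (v i.+1 j).
rewrite -big_split /=.
rewrite (eq_bigr (fun i : 'I_m =>
  (\xor_(j < n) v i j) (+) (\xor_(j < n) v i.+1 j))); last first.
  by move=> i _; apply: row.
exact: (xor_telescope m (fun i => \xor_(j < n) v i j)).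
Qed.

Section Plane.
Variable R : realFieldType.
Implicit Types p q x y : R * R.

(** Upward vectors, with the horizontal direction split lexicographically so
    that of two opposite nonzero vectors exactly one is upper. *)
Definition upper p := (0 < p.2) || ((p.2 == 0) && (0 < p.1)).

Definition below x y := upper (y - x).

(** For two vectors close to each other and far from the origin, this tells
    whether the short way from p to q crosses the leftward ray: if they are on
    different sides of the horizontal axis, both are well to the left or well
    to the right of the origin. *)
Definition crosses p q := (upper p (+) upper q) && (p.1 < 0).

(** The rotation of the vector from x to the walker, modulo 2, when g is
    sampled finely enough. *)
Definition turn m (g : nat -> R * R) x :=
  \xor_(i < m) crosses (g i - x) (g i.+1 - x).

Lemma upperN p : p != 0 -> upper (- p) = ~~ upper p.
Proof.
case: p => a b p0; rewrite /upper -[- (a, b)]/(- a, - b) /=.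
have {p0} : ~~ ((a == 0) && (b == 0)).
  by apply: contra p0 => /andP[/eqP-> /eqP->].
rewrite !oppr_gt0 oppr_eq0; case: (ltrgtP b 0) => //= _; rewrite andbT => a0.
by rewrite lt_neqAle a0 leNgt.
Qed.

Lemma belowC x y : x != y -> below y x = ~~ below x y.
Proof. by move=> xy; rewrite /below -upperN ?opprB // subr_eq0 eq_sym. Qed.

Definition clear d p := (d <= `|p.1|) || (d <= `|p.2|).

Definition nearby d p q := (`|p.1 - q.1| < d) && (`|p.2 - q.2| < d).

Lemma nearbyC d p q : nearby d p q = nearby d q p.
Proof. by rewrite /nearby distrC (distrC p.2). Qed.

Lemma upper_ge0 p : upper p -> 0 <= p.2.
Proof. by rewrite /upper => /orP[/ltW //|/andP[/eqP-> _]]. Qed.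

Lemma upper_le0 p : ~~ upper p -> p.2 <= 0.
Proof. by rewrite /upper negb_or -leNgt => /andP[]. Qed.

(** If p and q lie on different sides of the horizontal axis, they are close
    to it; a nearby vector r, which is far from the origin, then has a large
    first coordinate, of the same sign as that of p. *)
Lemma clear_half_plane d p q r : nearby d p q -> nearby d p r ->
    clear (d *+ 2) r -> upper p != upper q ->
  (p.1 < 0) = (r.1 < 0) /\ r.1 != 0.
Proof.
move=> /andP[pq1 pq2] /andP[pr1 pr2] cr upq.
have p2 : `|p.2| < d.
  move: upq; case up: (upper p); case uq: (upper q) => //= _.
    have := upper_ge0 up; have := upper_le0 (negbT uq).
    by move: pq2; rewrite !ltr_norml => *; lra.
  have := upper_ge0 uq; have := upper_le0 (negbT up).
  by move: pq2; rewrite !ltr_norml => *; lra.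
have r2 : `|r.2| < d *+ 2.
  by move: pr2 p2; rewrite !ltr_norml => *; lra.
have r1 : d *+ 2 <= `|r.1|.
  by move: cr; rewrite /clear [_ <= `|r.2|]leNgt r2 orbF.
move: r1 pr1; rewrite ler_normr ltr_norml => /orP[] H /andP[h1 h2].
  by rewrite !ltNge; split; [congr (~~ _); apply/idP/idP|]; lra.
by split; [apply/idP/idP|]; lra.
Qed.

Lemma crosses_trans d p q r : nearby d p q -> nearby d q r -> nearby d p r ->
    clear (d *+ 2) p -> clear (d *+ 2) q -> clear (d *+ 2) r ->
  crosses p q (+) crosses q r = crosses p r.
Proof.
move=> pq qr pr cp cq cr; have rp := pr; have rq := qr; have qp := pq.
rewrite nearbyC in rp; rewrite nearbyC in rq; rewrite nearbyC in qp.
have sgn x y z : nearby d x y -> nearby d x z -> clear (d *+ 2) z ->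
    upper x (+) upper y -> (x.1 < 0) = (z.1 < 0).
  move=> xy xz cz; rewrite addbC -negb_eqb eq_sym.
  by move=> /(clear_half_plane xy xz cz)[].
rewrite /crosses; have := sgn _ _ _ pq pr cr; have := sgn _ _ _ pr pq cq.
have := sgn _ _ _ qr qp cp.
case: (upper p); case: (upper q); case: (upper r) => //=;
  case: (p.1 < 0); case: (q.1 < 0); case: (r.1 < 0) => //= h1 h2 h3;
  first [by have := h1 isT | by have := h2 isT | by have := h3 isT].
Qed.

(** Turning p and q around the origin exchanges the leftward and the rightward
    ray, and a change of side crosses exactly one of them. *)
Lemma crossesN d p q : nearby d p q -> clear (d *+ 2) p -> clear (d *+ 2) q ->
    p != 0 -> q != 0 ->
  crosses (- p) (- q) = crosses p q (+) (upper p (+) upper q).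
Proof.
move=> pq cp cq p0 q0; rewrite /crosses !upperN //.
have pp : nearby d p p.
  move: pq; rewrite /nearby !subrr normr0 => /andP[h _].
  by rewrite (le_lt_trans _ h).
have := clear_half_plane pq pp cp; rewrite -[(- p).1]/(- p.1) oppr_lt0.
case: (upper p); case: (upper q) => //= /(_ isT)[_];
 by case: (ltrgtP p.1 0).
Qed.

Lemma clear_neq0 d p : 0 < d -> clear d p -> p != 0.
Proof.
move=> d0; apply: contraTneq => ->.
by rewrite /clear /= normr0 orbb -ltNge.
Qed.

Lemma nearbyBr d p q x : nearby d (p - x) (q - x) = nearby d p q.
Proof.
rewrite /nearby -[(p - x).1]/(p.1 - x.1) -[(p - x).2]/(p.2 - x.2).
rewrite -[(q - x).1]/(q.1 - x.1) -[(q - x).2]/(q.2 - x.2).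
by congr (_ && _); congr (`|_| < d); ring.
Qed.

Lemma nearbyBl d p q x : nearby d (x - p) (x - q) = nearby d p q.
Proof.
rewrite [RHS]nearbyC /nearby -[(x - p).1]/(x.1 - p.1) -[(x - p).2]/(x.2 - p.2).
rewrite -[(x - q).1]/(x.1 - q.1) -[(x - q).2]/(x.2 - q.2).
by congr (_ && _); congr (`|_| < d); ring.
Qed.

Lemma nearby_trans d d' p q r :
  nearby d p q -> nearby d' q r -> nearby (d + d') p r.
Proof.
by move=> /andP[h1 h2] /andP[h3 h4]; apply/andP; split;
  [have := ler_distD q.1 p.1 r.1 | have := ler_distD q.2 p.2 r.2]; lra.
Qed.

Lemma nearby_weak d d' p q : d <= d' -> nearby d p q -> nearby d' p q.
Proof.
by move=> dd' /andP[h1 h2]; rewrite /nearby !(lt_le_trans _ dd').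
Qed.

(** The crossings of the ray by g i - h j along the border of the square
    [0, m] x [0, m] sum to zero, since they do so around each cell. Two sides of
    the square are turnings of g, the other two are turnings of h seen
    backwards, for which [crossesN] gives a telescoping correction. *)
Lemma turn_exchange m d (g h : nat -> R * R) : 0 < d ->
    (forall i, (i < m)%N -> nearby d (g i) (g i.+1)) ->
    (forall j, (j < m)%N -> nearby d (h j) (h j.+1)) ->
    (forall i j, (i <= m)%N -> (j <= m)%N -> clear (d *+ 4) (g i - h j)) ->
  (turn m g (h 0%N) (+) turn m g (h m)) (+)
    (turn m h (g 0%N) (+) turn m h (g m)) =
  (below (h 0%N) (g 0%N) (+) below (h m) (g 0%N)) (+)
    (below (h 0%N) (g m) (+) below (h m) (g m)).
Proof.
move=> d0 gs hs gh.
have d2 : d <= d *+ 2 by rewrite mulr2n lerDl ltW.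
have cl i j : (i <= m)%N -> (j <= m)%N -> clear (d *+ 2 *+ 2) (g i - h j).
  by rewrite -mulrnA; apply: gh.
have nz i j : (i <= m)%N -> (j <= m)%N -> g i - h j != 0.
  by move=> im jm; apply: clear_neq0 (gh i j im jm); rewrite pmulrn_lgt0.
have stepg i j : (i < m)%N -> nearby (d *+ 2) (g i - h j) (g i.+1 - h j).
  by move=> im; rewrite nearbyBr (nearby_weak d2) // gs.
have steph i j : (j < m)%N -> nearby (d *+ 2) (g i - h j) (g i - h j.+1).
  by move=> jm; rewrite nearbyBl (nearby_weak d2) // hs.
have stepgh i j : (i < m)%N -> (j < m)%N ->
    nearby (d *+ 2) (g i - h j) (g i.+1 - h j.+1).
  move=> im jm; rewrite mulr2n; apply: (@nearby_trans _ _ _ (g i.+1 - h j)).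
    by rewrite nearbyBr gs.
  by rewrite nearbyBl hs.
have bdry := @xor_grid_boundary m m
  (fun i j => crosses (g i - h j) (g i.+1 - h j))
  (fun i j => crosses (g i - h j) (g i - h j.+1)).
rewrite /turn in bdry *; rewrite {}bdry; last first.
  move=> i j im jm; have im' := ltnW im; have jm' := ltnW jm.
  have e1 := crosses_trans (stepg i j im) (steph i.+1 j jm) (stepgh i j im jm)
    (cl _ _ im' jm') (cl _ _ im jm') (cl _ _ im jm).
  have e2 := crosses_trans (steph i j jm) (stepg i j.+1 im) (stepgh i j im jm)
    (cl _ _ im' jm') (cl _ _ im' jm) (cl _ _ im jm).
  by rewrite -e2 in e1; move: e1; do 4!case: (crosses _ _).
have turnh i : (i <= m)%N ->
    \xor_(j < m) crosses (h j - g i) (h j.+1 - g i) =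
    (\xor_(j < m) crosses (g i - h j) (g i - h j.+1)) (+)
      (below (h 0%N) (g i) (+) below (h m) (g i)).
  move=> im; rewrite -(xor_telescope m (fun j => below (h j) (g i))) -big_split.
  apply: eq_bigr => j _; have jm := ltn_ord j.
  rewrite -(opprB (g i) (h j)) -(opprB (g i) (h j.+1)).
  by rewrite (@crossesN (d *+ 2)) ?cl ?nz ?steph // ltnW.
rewrite !turnh //.
by do 2!case: (\big[_/_]_(_ < _) _); do 4!case: (below _ _).
Qed.

(** Seen from x, a walk in an open half plane with x on its border meets the
    horizontal axis only on one side of x. It thus crosses the leftward ray
    either never or at each passage through the axis, as the inner normal of
    the half plane points to the right or to the left. *)
Lemma turn_half_plane m d (g : nat -> R * R) x (nu : R * R) : 0 < d ->
    (forall i, (i < m)%N -> nearby d (g i) (g i.+1)) ->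
    (forall i, (i <= m)%N -> clear (d *+ 2) (g i - x)) ->
    (forall i, (i <= m)%N ->
      ((g i).1 - x.1) * nu.1 + ((g i).2 - x.2) * nu.2 < 0) ->
  turn m g x = (0 < nu.1) && (below x (g 0%N) (+) below x (g m)).
Proof.
move=> d0 gs gx gnu.
rewrite andbC -(xor_telescope m (fun i => below x (g i))).
rewrite (big_morph (fun b => b && (0 < nu.1)) (id1 := false) (op1 := addb)) //;
  last by move=> b c; rewrite andb_addl.
apply: eq_bigr => i _; have im := ltn_ord i.
have st : nearby d (g i - x) (g i.+1 - x) by rewrite nearbyBr gs.
have := gnu i (ltnW im); have := gnu i.+1 im.
have pp : nearby d (g i - x) (g i - x).
  by rewrite /nearby !subrr normr0 d0.
have := clear_half_plane st pp (gx i (ltnW im)).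
have := clear_half_plane st st (gx i.+1 im).
rewrite /crosses /below.
have u0 := @upper_ge0 (g i - x); have l0 := @upper_le0 (g i - x).
have u1 := @upper_ge0 (g i.+1 - x); have l1 := @upper_le0 (g i.+1 - x).
move: u0 u1 l0 l1.
rewrite -[(g i - x).1]/((g i).1 - x.1) -[(g i - x).2]/((g i).2 - x.2).
rewrite -[(g i.+1 - x).1]/((g i.+1).1 - x.1).
rewrite -[(g i.+1 - x).2]/((g i.+1).2 - x.2).
set a := (g i).1 - x.1; set b := (g i).2 - x.2.
set a' := (g i.+1).1 - x.1; set b' := (g i.+1).2 - x.2.
(* One of b * nu.2 and b' * nu.2 is nonnegative, which fixes the sign of the
   other product in the corresponding hypothesis. *)
have key : b * b' <= 0 -> (a < 0) = (a' < 0) -> a != 0 -> a' != 0 ->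
    a' * nu.1 + b' * nu.2 < 0 -> a * nu.1 + b * nu.2 < 0 ->
    (a < 0) = (0 < nu.1).
  move=> bb aa a0 a'0 h1 h2.
  have [h|h] : (a * nu.1 < 0) \/ (a' * nu.1 < 0).
    by case: (leP 0 (b * nu.2)) => h; [left|right]; nra.
  - by move: a0 h; case: (ltrgtP a 0) => // ha _ h; apply/esym; nra.
  by move: a'0 h aa; case: (ltrgtP a' 0) => // ha _ h ->; apply/esym; nra.
case: (upper (g i - x)); case: (upper (g i.+1 - x)) => //= u0 u1 l0 l1
  /(_ isT)[h1 h2] /(_ isT)[h3 h4] h5 h6; apply: key => //.
  by have := u0 isT; have := l1 isT; nra.
by have := u1 isT; have := l0 isT; nra.
Qed.

End Plane.

(** * Uniform meshes on arcs *)

Section Arcs.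
Local Open Scope classical_set_scope.
Variable R : realType.
Implicit Types g h : R -> R * R.

Lemma clear_norm (d : R) (p : R * R) : clear d p = (d <= `|p|).
Proof. by rewrite /clear prod_normE /= le_max. Qed.

Lemma nearby_norm (d : R) (p q : R * R) : nearby d p q = (`|p - q| < d).
Proof. by rewrite /nearby prod_normE /= gt_max. Qed.

Lemma arc_uniform g (d : R) : {within `[0, 1], continuous g}%classic -> 0 < d ->
  exists2 r : R, 0 < r &
    {in `[0, 1]%R &, forall s t, `|s - t| < r -> nearby d (g s) (g t)}.
Proof.
move=> /subspace_continuousP cg d0.
have d20 : 0 < d / 2 by rewrite divr_gt0.
pose P (r s : R) :=
  forall t, t \in `[0, 1]%R -> `|s - t| < r -> nearby d (g s) (g t).
have small : \forall r \near (0 : R)^'+, `[0, 1] `<=` P r.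
  have := @segment_compact R 0 1.
  move=> /compact_near_coveringP/near_covering_withinP; apply.
  move=> s s01; have := cg s s01.
  move=> /cvgrPdist_lt/(_ _ d20).
  rewrite near_withinE => /nbhs_ballP[e /= e0 he].
  have e20 : 0 < e / 2 by rewrite divr_gt0.
  exists (ball s (e / 2), [set r | r < e / 2])%classic.
    split; first exact: nbhsx_ballx.
    exact: nbhs_right_lt.
  move=> [s' r] [/= ss' re] s'01 t t01 s't.
  have {}ss' : `|s - s'| < e / 2 by [].
  have {}re : r < e / 2 by [].
  have h1 : `|g s - g s'| < d / 2.
    by apply: he => //; apply: lt_le_trans ss' _; lra.
  have h2 : `|g s - g t| < d / 2.
    apply: he => //; rewrite /ball /=.
    by have := ler_distD s' s t; lra.
  rewrite nearby_norm; have := ler_distD (g s) (g s') (g t).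
  by rewrite (distrC (g s') (g s)); lra.
have [r [r0 hr]] : exists r : R, 0 < r /\ `[0, 1] `<=` P r.
  near (0 : R)^'+ => r; exists r.
  by split; near: r => //; exact: nbhs_right_gt.
by exists r => // s t s01 t01; exact: hr.
Unshelve. all: end_near.
Qed.

Lemma arcs_apart g h :
    {within `[0, 1], continuous g}%classic ->
    {within `[0, 1], continuous h}%classic ->
    {in `[0, 1]%R &, forall s t, g s <> h t} ->
  exists2 d : R, 0 < d & {in `[0, 1]%R &, forall s t, clear d (g s - h t)}.
Proof.
move=> cg ch gh.
set I := `[0 : R, 1]%classic.
have cI : compact I by exact: segment_compact.
have I0 : I 0 by rewrite /I /= in_itv /= lexx ler01.
pose f (pq : (R * R) * (R * R)) : R := `|pq.1 - pq.2|.
have cf : continuous f.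
  move=> pq; apply: cvg_norm; apply: cvgB; [exact: cvg_fst|exact: cvg_snd].
have [|||c] := @compact_EVT_min _ R f (g @` I `*` h @` I).
- by exists (g 0, h 0); split; exists 0.
- by apply: compact_setX; apply: continuous_compact.
- exact: continuous_subspaceT.
rewrite inE => -[[s Is gs] [t It ht]] minc.
exists (f c).
  rewrite normr_gt0 subr_eq0 -gs -ht; apply/eqP; exact: gh.
move=> s' t' Is' It'; rewrite clear_norm; apply: (minc (g s', h t')).
by rewrite inE; split; [exists s'|exists t'].
Qed.
End Arcs.

(** * Turning numbers of the edges of a planar drawing *)

Lemma finite_uniform_bound (R : realType) (I : finType) (P : I -> R -> Prop) :
    (forall i, exists2 d, 0 < d & P i d) ->
    (forall i d d', d' <= d -> P i d -> P i d') ->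
  exists2 d, 0 < d & forall i, P i d.
Proof.
move=> exP decP.
have /boolp.choice[f fP] : forall i, exists d, 0 < d /\ P i d.
  by move=> i; have [d] := exP i; exists d.
exists (\big[Order.min/1]_i f i).
  apply: (big_ind (fun x => 0 < x)) => // [x y x0 y0|i _].
    by rewrite lt_min x0.
  by case: (fP i).
move=> i; apply: (decP i (f i)); last by case: (fP i).
exact: bigmin_le_cond.
Qed.

Lemma set2_inj (T : finType) (u v a b : T) :
  [set u; v]%SET = [set a; b]%SET -> a = u /\ b = v \/ a = v /\ b = u.
Proof.
move=> uvab.
have /set2P[au|av] : a \in [set u; v]%SET by rewrite uvab set21.
  left; split=> //; have : v \in [set a; b]%SET by rewrite -uvab set22.
  have /set2P[->|//] : b \in [set u; v]%SET by rewrite uvab set22.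
  by rewrite au => /set2P[].
right; split=> //; have : u \in [set a; b]%SET by rewrite -uvab set21.
have /set2P[//|->] : b \in [set u; v]%SET by rewrite uvab set22.
by rewrite av => /set2P[].
Qed.

Section Drawing.
Variables (R : realType) (n : nat) (G : bdgraph n) (D : disc_embedding R G).
Implicit Types (e f : edge G) (x y v : vertex G).

Definition vbelow x y := below (Defs.pos D x) (Defs.pos D y).

Definition rightwards x := (Defs.center D).1 < (Defs.pos D x).1.

Lemma vbelowC x y : x != y -> vbelow y x = ~~ vbelow x y.
Proof. by move=> xy; rewrite /vbelow belowC // (inj_eq (@pos_inj _ _ _ D)). Qed.

Lemma arc_apart e f : [disjoint ends e & ends f]%SET ->
  {in `[0, 1]%R &, forall s t, Defs.arc D e s <> Defs.arc D f t}.
Proof.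
move=> /disjointFr dis s t s01 t01 est.
have ef : e != f.
  apply/eqP => ef; have [u [w [ee _ _]]] := arc_ends D e.
  have ue : u \in ends e by rewrite ee set21.
  by have := dis _ ue; rewrite -ef ue.
have [v ev] := arc_arc ef s01 t01 est.
have := dis _ (arc_vertex s01 ev).
by rewrite (arc_vertex t01 (etrans (esym est) ev)).
Qed.

(** A mesh fine enough for all the edges at once: its steps are four times
    shorter than the distance between any two disjoint edges and between any
    edge and any vertex outside it, as [turn_exchange] requires. *)
Lemma arc_mesh : exists (d : R) (m : nat) (g : edge G -> nat -> R * R),
  [/\ 0 < d,
      forall e i, (i < m)%N -> nearby d (g e i) (g e i.+1),
      forall e, g e 0%N = Defs.arc D e 0 /\ g e m = Defs.arc D e 1,
      forall e i, (i <= m)%N ->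
        exists2 s, s \in `[0, 1]%R & g e i = Defs.arc D e s
    & (forall e f, [disjoint ends e & ends f]%SET -> forall i j,
        (i <= m)%N -> (j <= m)%N -> clear (d *+ 4) (g e i - g f j)) /\
      (forall e x, x \notin ends e -> forall i, (i <= m)%N ->
        clear (d *+ 4) (g e i - Defs.pos D x))].
Proof.
have clearW (d d' : R) p : d' <= d -> clear d p -> clear d' p.
  by move=> dd'; rewrite !clear_norm; apply: le_trans.
have [d1 d1_gt0 apart_e] : exists2 d : R, 0 < d & forall ef : edge G * edge G,
    [disjoint ends ef.1 & ends ef.2]%SET ->
    {in `[0, 1]%R &, forall s t,
      clear d (Defs.arc D ef.1 s - Defs.arc D ef.2 t)}.
  apply: finite_uniform_bound => [[e f] /=|[e f] d d' dd' /= clr dis].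
    have [dis|_] := boolP [disjoint ends e & ends f]%SET; last by exists 1.
    have := arcs_apart (@arc_continuous _ _ _ D e) (@arc_continuous _ _ _ D f)
      (arc_apart dis).
    by case=> d d0 clr; exists d.
  by move=> s t s01 t01; apply: clearW dd' (clr dis s t s01 t01).
have [d2 d2_gt0 apart_x] : exists2 d : R, 0 < d & forall ex : edge G * vertex G,
    ex.2 \notin ends ex.1 ->
    {in `[0, 1]%R, forall s, clear d (Defs.arc D ex.1 s - Defs.pos D ex.2)}.
  apply: finite_uniform_bound => [[e x] /=|[e x] d d' dd' /= clr dis].
    have [xe|_] := boolP (x \notin ends e); last by exists 1.
    have [||d d0 clr] := @arcs_apart R (Defs.arc D e) (fun=> Defs.pos D x)
      (@arc_continuous _ _ _ D e).
    - by apply: continuous_subspaceT => ?; exact: cvg_cst.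
    - move=> s t s01 _ esx; case/negP: xe; exact: arc_vertex s01 esx.
    exists d => // _ s s01.
    by apply: (clr s 0) => //; rewrite in_itv /= lexx ler01.
  by move=> s s01; apply: clearW dd' (clr dis s s01).
pose d := Order.min d1 d2 / 4.
have d_gt0 : 0 < d by rewrite divr_gt0 // lt_min d1_gt0.
have d4 : d *+ 4 = Order.min d1 d2 by rewrite /d -mulr_natr divfK.
have [r r_gt0 uni] : exists2 r : R, 0 < r & forall e,
    {in `[0, 1]%R &, forall s t, `|s - t| < r ->
      nearby d (Defs.arc D e s) (Defs.arc D e t)}.
  apply: finite_uniform_bound => [e|e r r' rr' near_r s t s01 t01 st].
    exact: arc_uniform (@arc_continuous _ _ _ D e) d_gt0.
  by apply: near_r => //; apply: lt_le_trans st rr'.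
pose m := (Num.truncn r^-1).+1.
have m0 : (0 : R) < m%:R by rewrite ltr0n.
have mr : m%:R^-1 < r.
  rewrite invf_plt ?posrE //.
  by have /truncn_itv/andP[] : 0 <= r^-1 by rewrite invr_ge0 ltW.
have s01 i : (i <= m)%N -> i%:R / m%:R \in `[0 : R, 1]%R.
  move=> im; rewrite in_itv /= divr_ge0 ?ler0n //=.
  by rewrite ler_pdivrMr // mul1r ler_nat.
exists d, m, (fun e i => Defs.arc D e (i%:R / m%:R)); split=> //.
- move=> e i im; apply: uni; rewrite ?s01 ?(ltnW im) //.
  rewrite -mulrBl -natr1 opprD addrA subrr sub0r mulN1r normrN.
  by rewrite gtr0_norm ?invr_gt0.
- by move=> e; rewrite mul0r divff ?gt_eqF.
- by move=> e i im; exists (i%:R / m%:R) => //; exact: s01.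
rewrite d4; split=> [e f dis i j im jm|e x xe i im].
  apply: (clearW d1); first by rewrite ge_min lexx.
  by apply: (apart_e (e, f)) => //; exact: s01.
apply: (clearW d2); first by rewrite ge_min lexx orbT.
by apply: (apart_x (e, x)) => //; exact: s01.
Qed.

(** A disc lies strictly on one side of its tangent at any of its border
    points, this point excepted. *)
Lemma boundary_tangent x (p : R * R) : x \in boundary G ->
    in_disc (Defs.center D) (Defs.radius D) p -> p != Defs.pos D x ->
  (p.1 - (Defs.pos D x).1) * ((Defs.pos D x).1 - (Defs.center D).1) +
  (p.2 - (Defs.pos D x).2) * ((Defs.pos D x).2 - (Defs.center D).2) < 0.
Proof.
move=> /imsetP[j _ ->]; have [theta [-> _ _]] := pos_boundary D.
rewrite /in_disc; move: (Defs.center D) (Defs.radius D) => c r /=.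
have := cos2Dsin2 (theta j); move: (cos _) (sin _) => a b ab pc px.
have {px} px : 0 < (p.1 - (c.1 + r * a)) ^+ 2 + (p.2 - (c.2 + r * b)) ^+ 2.
  rewrite lt_neqAle addr_ge0 ?sqr_ge0 // andbT eq_sym paddr_eq0 ?sqr_ge0 //.
  rewrite !sqrf_eq0 !subr_eq0; apply: contra px => /andP[/eqP h1 /eqP h2].
  by rewrite [p]surjective_pairing h1 h2.
have : r ^+ 2 = r ^+ 2 * (a ^+ 2 + b ^+ 2) by rewrite ab mulr1.
nra.
Qed.

Lemma exists_turning : exists t : edge G -> vertex G -> bool,
  (forall e f a b c d, ends e = [set a; b]%SET -> ends f = [set c; d]%SET ->
     [disjoint ends e & ends f]%SET ->
     (t e c (+) t e d) (+) (t f a (+) t f b) =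
     (vbelow c a (+) vbelow d a) (+) (vbelow c b (+) vbelow d b)) /\
  (forall x e a b, x \in boundary G -> x \notin ends e ->
     ends e = [set a; b]%SET ->
     t e x = rightwards x && (vbelow x a (+) vbelow x b)).
Proof.
have [d [m [g [d_gt0 step g01 gon [gdis gx]]]]] := arc_mesh.
exists (fun e x => turn m (g e) (Defs.pos D x)).
split=> [e f a b c b'|x e a b xG xe eab].
  move=> eab fcd dis.
  have [u [v [euv eu ev]]] := arc_ends D e.
  have [w [z [fwz fw fz]]] := arc_ends D f.
  have [[ge0 gem] [gf0 gfm]] := (g01 e, g01 f).
  have := turn_exchange d_gt0 (step e) (step f) (gdis e f dis).
  rewrite ge0 gem gf0 gfm eu ev fw fz -!/(vbelow _ _).
  rewrite euv in eab; rewrite fwz in fcd.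
  have [[-> ->]|[-> ->]] := set2_inj eab;
  have [[-> ->]|[-> ->]] := set2_inj fcd;
  move: (turn m (g e) (Defs.pos D w)) (turn m (g e) (Defs.pos D z))
        (turn m (g f) (Defs.pos D u)) (turn m (g f) (Defs.pos D v));
  by do 4!case; do 4!case: (vbelow _ _).
have [u [v [euv eu ev]]] := arc_ends D e.
rewrite euv in eab.
have -> : turn m (g e) (Defs.pos D x) =
    rightwards x && (vbelow x u (+) vbelow x v).
  have clr : forall i, (i <= m)%N -> clear (d *+ 2) (g e i - Defs.pos D x).
    move=> i im; have := gx e x xe i im; rewrite !clear_norm; apply: le_trans.
    by rewrite ler_pMn2l.
  pose nu := Defs.pos D x - Defs.center D.
  rewrite (turn_half_plane (nu := nu) d_gt0 (step e) clr).
    have [-> ->] := g01 e; rewrite eu ev /rightwards.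
    by rewrite -[(_ - _).1]/(_.1 - _.1) subr_gt0.
  move=> i im; have [s s01 gs] := gon e i im.
  apply: boundary_tangent => //; first by rewrite gs; exact: arc_in_disc.
  by rewrite gs; apply/eqP => /(arc_vertex s01); apply/negP.
by have [[-> ->]|[-> ->]] := set2_inj eab; rewrite // addbC.
Qed.
End Drawing.

(** * Points of a circle and their height *)

Section Circle.
Variable R : realType.

Lemma cos_sin_periodic (x : R) (q : int) :
  (cos (x + q%:~R * (pi *+ 2)) = cos x) * (sin (x + q%:~R * (pi *+ 2)) = sin x).
Proof.
have pos (y : R) (m : nat) : (cos (y + m%:~R * (pi *+ 2)) = cos y) *
    (sin (y + m%:~R * (pi *+ 2)) = sin y).
  rewrite -pmulrn mulr_natl.
  by split; apply: periodicn; [exact: cosD2pi|exact: sinD2pi].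
case: q => m; first exact: pos.
rewrite NegzE mulrNz mulNr; set t := _ * _.
have xE : x = x - t + m.+1%:~R * (pi *+ 2) by rewrite subrK.
by have [hc hs] := pos (x - t) m.+1; rewrite -xE in hc hs.
Qed.

(** The interval is closed above so that the lowest point of the circle comes
    last, after the left half circle to which it belongs. *)
Lemma principal_angle (x : R) : exists q : int,
  - (pi / 2) < x - q%:~R * (pi *+ 2) <= pi + pi / 2.
Proof.
have pi2 : 0 < pi *+ 2 :> R by rewrite pmulrn_lgt0 // pi_gt0.
exists (Num.ceil ((x - (pi + pi / 2)) / (pi *+ 2))).
have /andP[] := ceil_itv ((x - (pi + pi / 2)) / (pi *+ 2)).
rewrite intrB ltr_pdivlMr // ler_pdivrMr //.
rewrite mulrBl mul1r; move: (_%:~R * _) => y h1 h2.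
by apply/andP; split; lra.
Qed.

Lemma odd_absz_succ (q : int) : odd `|q + 1| = ~~ odd `|q|.
Proof. lia. Qed.

Variables (c : R * R) (r : R).
Hypothesis r_gt0 : 0 < r.

Definition circle_pt (a : R) : R * R := (c.1 + r * cos a, c.2 + r * sin a).

(** On a circle run through counterclockwise from the bottom, height increases
    on the right half and decreases on the left half, and the right half comes
    first. Comparing two points by height, with a correction for the sides on
    which they lie, therefore amounts to comparing them along the circle, as
    [circle_swap_lt] shows. *)
Definition circle_swap (p q : R * R) : bool :=
  (~~ (c.1 < p.1) && below p q) (+) ((c.1 < q.1) && below q p).

Lemma below_snd (p q : R * R) : p.2 < q.2 -> below p q /\ ~~ below q p.
Proof.
move=> pq; rewrite /below /upper.
rewrite -[(q - p).2]/(q.2 - p.2) -[(p - q).2]/(p.2 - q.2).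
rewrite subr_gt0 pq; split=> //; rewrite negb_or subr_gt0 -leNgt ltW //=.
by rewrite subr_eq0 lt_eqF.
Qed.

Lemma circle_pt_right a : - (pi / 2) < a -> a <= pi + pi / 2 ->
  (c.1 < (circle_pt a).1) = (a < pi / 2).
Proof.
move=> a1 a2; rewrite ltrDl pmulr_rgt0 //.
case: (ltP a (pi / 2)) => a3; first by rewrite cos_gt0_pihalf // a1.
apply/negbTE; rewrite -leNgt -[a](subrK pi) cosDpi oppr_le0.
by rewrite cos_ge0_pihalf //; apply/andP; split; lra.
Qed.

Lemma circle_swap_lt a b : - (pi / 2) < a -> a < b -> b <= pi + pi / 2 ->
  circle_swap (circle_pt a) (circle_pt b) = false.
Proof.
move=> a0 ab b0.
have b1 := lt_trans a0 ab; have a1 := ltW (lt_le_trans ab b0).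
rewrite /circle_swap !circle_pt_right //.
have pi0 := pi_gt0 R.
case: (ltP a (pi / 2)) => a2; case: (ltP b (pi / 2)) => b2 //=; [|lra|].
  have [] // := @below_snd (circle_pt a) (circle_pt b); last first.
    by move=> _ /negbTE.
  by rewrite /= ltrD2l ltr_pM2l // ltr_sin // in_itv /=; apply/andP; split; lra.
have [] // := @below_snd (circle_pt b) (circle_pt a); last first.
  by move=> _ /negbTE ->.
rewrite /= ltrD2l ltr_pM2l // -[a](subrK pi) -[b](subrK pi) !sinDpi ltrN2.
by rewrite ltr_sin ?in_itv /=; [lra| |]; apply/andP; split; lra.
Qed.

Lemma circle_swapC p q : p != q -> circle_swap q p = ~~ circle_swap p q.
Proof.
move=> pq; rewrite /circle_swap (belowC pq).
by case: (below p q); case: (_ < p.1); case: (_ < q.1).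
Qed.

(** The angles of the points differ by less than a full turn, so their winding
    numbers q take at most two consecutive values, which the parity of q tells
    apart; comparing two principal angles gives the same answer as comparing
    the angles unless q differs. The bit k is the orientation of the
    listing. *)
Lemma circularly_ordered_swap n (p : 'I_n -> R * R) : injective p ->
    circularly_ordered c r p ->
  exists (k : bool) (l : 'I_n -> bool), forall i j : 'I_n, (i < j)%N ->
    circle_swap (p i) (p j) = k (+) (l i (+) l j).
Proof.
move=> p_inj [theta [pE near mono]].
have /boolp.choice[q qP] := fun i => principal_angle (theta i).
pose t i := theta i - (q i)%:~R * (pi *+ 2).
have pt i : p i = circle_pt (t i).
  rewrite pE /circle_pt -[theta i](subrK ((q i)%:~R * (pi *+ 2))).
  by rewrite !cos_sin_periodic.
have swap i j : theta i < theta j ->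
    circle_swap (p i) (p j) = odd `|q i| (+) odd `|q j|.
  move=> ij; have nij := near i j.
  have pi2 : 0 < pi *+ 2 :> R by rewrite pmulrn_lgt0 // pi_gt0.
  have /andP[i1 i2] := qP i; have /andP[j1 j2] := qP j.
  have pij : p i != p j.
    by rewrite (inj_eq p_inj); apply: contraTneq ij => ->; rewrite ltxx.
  have nij' : theta j - theta i < 2 * pi.
    by apply: le_lt_trans nij; rewrite distrC ler_norm.
  have q1 : (q i <= q j)%R.
    rewrite -ltzD1 -(ltr_int R) intrD -(ltr_pM2r pi2).
    by rewrite mulrDl; lra.
  have q2 : (q j <= q i + 1)%R.
    rewrite -ltzD1 -(ltr_int R) !intrD -(ltr_pM2r pi2).
    by rewrite !mulrDl; lra.
  have [qij|qij] : q j = q i \/ q j = q i + 1 by lia.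
    rewrite qij addbb !pt; apply: circle_swap_lt => //.
    by rewrite /t qij ltrD2r.
  rewrite qij odd_absz_succ addbN addbb -[LHS]negbK -circle_swapC // !pt.
  rewrite circle_swap_lt // /t qij intrD mulrDl mul1r.
  by lra.
case: mono => mono.
  by exists false, (fun i => odd `|q i|) => i j ij; exact/swap/mono.
exists true, (fun i => odd `|q i|) => i j ij.
have ji := mono _ _ ij.
have pij : p j != p i by rewrite (inj_eq p_inj) -val_eqE /= gtn_eqF.
by rewrite circle_swapC // (swap _ _ ji) addbC.
Qed.

End Circle.

(** * Planar drawings as tournaments *)

(** The turnings around boundary vertices, which are known, are moved to the
    other side of the exchange identity; the comparison of heights on that
    side becomes the tournament h. *)
Lemma planar_sign_data (R : realType) n (G : bdgraph n)
    (D : disc_embedding R G) :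
  exists (t : edge G -> vertex G -> bool) (h : rel (vertex G))
         (k : bool) (l : 'I_n -> bool),
  [/\ forall x y, x != y -> h y x = ~~ h x y,
      forall e x, x \in boundary G -> t e x = false,
      forall e f a b c d, ends e = [set a; b] -> ends f = [set c; d] ->
        [disjoint ends e & ends f] ->
        (t e c (+) t e d) (+) (t f a (+) t f b) =
        (h c a (+) h d a) (+) (h c b (+) h d b)
    & forall i j : 'I_n, (i < j)%N ->
        h (bdvertex G i) (bdvertex G j) = k (+) (l i (+) l j)].
Proof.
have [t [t_exch t_bd]] := exists_turning D.
(* r x && (vbelow x a (+) vbelow x b) is the turning of an edge ab around a
   boundary vertex x; it is shared out between h x a and h x b. *)
pose r x := (x \in boundary G) && rightwards D x.
pose h x y := (~~ r x && vbelow D x y) (+) (r y && vbelow D y x).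
pose t' e x := (x \notin boundary G) && t e x.
have [|k [l kl]] := circularly_ordered_swap (radius_gt0 D) _ (pos_boundary D).
  by move=> i j /pos_inj/bdvertex_inj.
exists t', h, k, l; split=> [x y xy|e x xG|e f a b c d eab fcd dis|i j ij].
- rewrite /h (vbelowC D xy).
  by case: (r x); case: (r y); case: (vbelow D x y).
- by rewrite /t' xG.
- have t'E (e' : edge G) (x u v : vertex G) : ends e' = [set u; v] ->
      x \notin ends e' ->
      t' e' x = t e' x (+) (r x && (vbelow D x u (+) vbelow D x v)).
    move=> euv xe; rewrite /t' /r; case xG: (x \in boundary G);
      last by rewrite addbF.
    by rewrite (t_bd _ _ _ _ xG xe euv) addbb.
  have fe x : x \in ends f -> x \notin ends e.
    by move=> xf; rewrite (disjointFl dis).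
  have ef x : x \in ends e -> x \notin ends f.
    by move=> xf; rewrite (disjointFr dis).
  have nf : [/\ c \notin ends e, d \notin ends e, a \notin ends f
                & b \notin ends f].
    by split; [apply: fe|apply: fe|apply: ef|apply: ef];
       rewrite ?eab ?fcd ?set21 ?set22.
  case: nf => ce de af bf.
  rewrite !(t'E e _ a b) // !(t'E f _ c d) // /h.
  rewrite (addbACA (t e c)) (addbACA (t f a)) (addbACA (t e c (+) _)).
  rewrite (t_exch e f a b c d) //.
  have neq x y : x \in ends f -> y \in ends e -> x != y.
    by move=> xf ye; apply: contraTneq xf => ->; apply: ef.
  rewrite (@vbelowC _ _ _ D c a) ?(@vbelowC _ _ _ D c b) ?(@vbelowC _ _ _ D d a)
    ?(@vbelowC _ _ _ D d b) ?neq ?eab ?fcd ?set21 ?set22 //.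
  move: (vbelow D c a) (vbelow D c b) (vbelow D d a) (vbelow D d b).
  by do 4!case: (r _); do 4!case.
have ijn : bdvertex G i != bdvertex G j.
  by rewrite (inj_eq (@bdvertex_inj _ G)) -val_eqE /= ltn_eqF.
rewrite -kl // /h /circle_swap /r !mem_imset ?inE //=; exact: bdvertex_inj.
Qed.

(** * Inversions and the sign of a matching *)

Lemma xor_pairs m (t : 'I_m -> 'I_m -> bool) :
  \xor_(i < m) \xor_(j < m | (i < j)%N) (t i j (+) t j i) =
  \xor_(i < m) \xor_(j < m | j != i) t i j.
Proof.
transitivity ((\xor_(i < m) \xor_(j < m | (i < j)%N) t i j) (+)
              (\xor_(i < m) \xor_(j < m | (j < i)%N) t i j)).
  rewrite [X in _ = _ (+) X](exchange_big_dep xpredT) //= -big_split /=.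
  by apply: eq_bigr => i _; rewrite big_split.
rewrite -big_split; apply: eq_bigr => i _.
rewrite /= [RHS](bigID (fun j : 'I_m => (i < j)%N)) /=; congr (_ (+) _).
  apply: eq_bigl => j; rewrite -val_eqE /=; lia.
apply: eq_bigl => j; rewrite -val_eqE /=; lia.
Qed.

Lemma odd_sum (I : Type) (s : seq I) (P : pred I) (F : I -> nat) :
  odd (\sum_(i <- s | P i) F i) = \big[addb/false]_(i <- s | P i) odd (F i).
Proof. exact: (big_morph odd oddD). Qed.

(** A sum over the pairs i < j of a symmetric function is half of its sum over
    all pairs of distinct indices, which a permutation preserves. Halving
    makes no sense modulo 2, hence the detour through natural numbers. *)
Lemma xor_pairs_perm m (s : 'I_m -> 'I_m -> bool) (p : 'S_m) :
    (forall i j, s i j = s j i) ->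
  \xor_(i < m) \xor_(j < m | (i < j)%N) s (p i) (p j) =
  \xor_(i < m) \xor_(j < m | (i < j)%N) s i j.
Proof.
move=> sC; pose S (u : 'I_m -> 'I_m -> bool) :=
  (\sum_(i < m) \sum_(j < m | (i < j)%N) u i j)%N.
have oddS u : \xor_(i < m) \xor_(j < m | (i < j)%N) u i j = odd (S u).
  rewrite odd_sum; apply: eq_bigr => i _; rewrite odd_sum.
  by apply: eq_bigr => j _; rewrite oddb.
have doubleS u : (forall i j, u i j = u j i) ->
    (S u).*2 = (\sum_(i < m) \sum_(j < m | j != i) u i j)%N.
  move=> uC; rewrite -addnn {2}/S (exchange_big_dep xpredT) //= -big_split /=.
  apply: eq_bigr => i _.
  rewrite [RHS](bigID (fun j : 'I_m => (i < j)%N)) /=; congr (_ + _)%N.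
    by apply: eq_bigl => j; rewrite -val_eqE /=; lia.
  by apply: eq_big => [j|j _]; [rewrite -val_eqE /=; lia|rewrite uC].
rewrite !oddS; congr odd; apply: double_inj; rewrite !doubleS //.
rewrite [RHS](reindex_inj (@perm_inj _ p)); apply: eq_bigr => i _.
rewrite [RHS](reindex_inj (@perm_inj _ p)); apply: eq_bigl => j.
by rewrite (inj_eq (@perm_inj _ p)).
Qed.

(** Permuting the nodes of a Vandermonde determinant multiplies it by the sign
    of the permutation, and the product formula shows that each inversion
    contributes a sign. *)
Lemma xor_inversions m (p : 'S_m) :
  \xor_(i < m) \xor_(j < m | (i < j)%N) (p j < p i)%N = odd_perm p.
Proof.
pose a (q : 'S_m) : 'rV[int]_m := \row_i (q i)%:Z.
have vdm : \det (Vandermonde m (a p)) =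
    \det (Vandermonde m (a 1%g)) * (-1) ^+ p.
  have -> : Vandermonde m (a p) = col_perm p (Vandermonde m (a 1%g)).
    by apply/matrixP => i j; rewrite !mxE perm1.
  by rewrite col_permE det_mulmx det_perm odd_permV.
have sg (q : 'S_m) : Num.sg (\det (Vandermonde m (a q))) =
    (-1) ^+ (\xor_(i < m) \xor_(j < m | (i < j)%N) (q j < q i)%N).
  rewrite det_Vandermonde (big_morph _ (@sgrM _) (@sgr1 _)).
  rewrite [RHS](big_morph _ (@signr_addb int) (erefl _)); apply: eq_bigr => i _.
  rewrite (big_morph _ (@sgrM _) (@sgr1 _)).
  rewrite [RHS](big_morph _ (@signr_addb int) (erefl _)).
  apply: eq_bigr => j ij.
  rewrite !mxE; case: ltnP => qij; first by rewrite ltr0_sg // subr_lt0 ltz_nat.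
  rewrite gtr0_sg // subr_gt0 ltz_nat ltn_neqAle qij andbT.
  by apply: contraTneq ij => /val_inj/perm_inj->; rewrite ltnn.
have no_inv : \xor_(i < m) \xor_(j < m | (i < j)%N)
    ((1%g : 'S_m) j < (1%g : 'S_m) i)%N = false.
  apply: big1 => i _; apply: big1 => j ij.
  by rewrite !perm1 ltnNge ltnW.
have := congr1 Num.sg vdm; rewrite sgrM !sg no_inv expr0 mul1r.
have -> : Num.sg ((-1) ^+ p : int) = (-1) ^+ p.
  by case: (odd_perm p); rewrite ?expr0 ?expr1 ?sgrN1 ?sgr1.
by move=> /eqP; rewrite (inj_eq (@signr_inj int)) => /eqP.
Qed.

(** The sum of a tournament with the order of the indices is symmetric, so the
    tournament has the same dependence on p as the order, which counts
    inversions. *)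
Lemma xor_tournament_perm m (h : rel 'I_m) (p : 'S_m) :
    (forall i j, i != j -> h j i = ~~ h i j) ->
  \xor_(i < m) \xor_(j < m | (i < j)%N) h (p i) (p j) =
  odd_perm p (+) \xor_(i < m) \xor_(j < m | (i < j)%N) h i j.
Proof.
move=> hC; pose s i j := h i j (+) (j < i)%N.
have sC i j : s i j = s j i.
  rewrite /s; case: (ltngtP i j) => [ij|ij|/val_inj-> //].
    by rewrite (hC i j) ?addbF ?addbT ?negbK // -val_eqE /= ltn_eqF.
  by rewrite (hC j i) ?addbF ?addbT ?negbK // -val_eqE /= ltn_eqF.
transitivity ((\xor_(i < m) \xor_(j < m | (i < j)%N) s (p i) (p j)) (+)
              odd_perm p).
  rewrite -xor_inversions -big_split; apply: eq_bigr => i _.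
  by rewrite -big_split; apply: eq_bigr => j _; rewrite /s /= addbK.
rewrite xor_pairs_perm // addbC; congr (_ (+) _).
apply: eq_bigr => i _; apply: eq_bigr => j ij.
by rewrite /s ltnNge ltnW // addbF.
Qed.

Section MatchingSign.
Variables (V E : finType) (ends : E -> {set V}).
Variables (t : E -> V -> bool) (h : rel V).
Hypothesis hC : forall x y, x != y -> h y x = ~~ h x y.
Hypothesis t_exchange : forall e f a b c d,
  ends e = [set a; b] -> ends f = [set c; d] -> [disjoint ends e & ends f] ->
  (t e c (+) t e d) (+) (t f a (+) t f b) =
  (h c a (+) h d a) (+) (h c b (+) h d b).

(** Summation of the exchange identity over the pairs of edges of a matching
    which joins a i to w (p i). Comparisons between two white vertices yield
    the sign of p by [xor_tournament_perm]; those between a black and a white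
    vertex run over the pairs which the matching does not join, and are
    collected at the white vertex. *)
Lemma matching_sign m (a w : 'I_m -> V) (e : 'I_m -> E) (p : 'S_m) :
    injective a -> injective w -> (forall i j, a i != w j) ->
    (forall i, ends (e i) = [set a i; w (p i)]) ->
  odd_perm p =
  (\xor_(i < m) \xor_(j < m | (i < j)%N) (h (a j) (a i) (+) true)) (+)
  (\xor_(i < m) \xor_(j < m | (i < j)%N) h (w j) (w i)) (+)
  \xor_(i < m) ((\xor_(j < m | j != i) t (e i) (a j)) (+)
                (\xor_(j < m | j != p i) t (e i) (w j)) (+)
                (h (a i) (w (p i)) (+) \xor_(j < m) h (a j) (w (p i)))).
Proof.
move=> a_inj w_inj aw eE.
have dis i j : i != j -> [disjoint ends (e i) & ends (e j)].
  move=> ij; rewrite !eE -setI_eq0; apply/eqP/setP => x; rewrite !inE.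
  apply/negP => /andP[/orP[]/eqP-> /orP[]];
    rewrite ?(negbTE (aw _ _)) ?(inj_eq a_inj) ?(inj_eq w_inj)
      ?(inj_eq perm_inj) ?(negbTE ij) //.
  by rewrite eq_sym (negbTE (aw _ _)).
have lhs : \xor_(i < m) \xor_(j < m | j != i)
      (t (e i) (a j) (+) t (e i) (w (p j))) =
    \xor_(i < m) \xor_(j < m | (i < j)%N)
      ((h (a j) (a i) (+) true) (+) h (w (p j)) (w (p i)) (+)
       (h (a i) (w (p j)) (+) h (a j) (w (p i)))).
  rewrite -xor_pairs; apply: eq_bigr => i _; apply: eq_bigr => j ij.
  have nij : i != j by rewrite -val_eqE /= ltn_eqF.
  rewrite (t_exchange (eE i) (eE j) (dis i j nij)).
  rewrite [h (w (p j)) (a i)](hC (aw i (p j))).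
  by do 4!case: (h _ _).
have cross : \xor_(i < m) \xor_(j < m | (i < j)%N)
      (h (a i) (w (p j)) (+) h (a j) (w (p i))) =
    \xor_(i < m) (h (a i) (w (p i)) (+) \xor_(j < m) h (a j) (w (p i))).
  rewrite (xor_pairs (fun i j => h (a i) (w (p j)))).
  rewrite (exchange_big_dep xpredT) //=.
  apply: eq_bigr => j _; rewrite [\xor_(i < m) _](bigD1 j) //= addKb.
  by apply: eq_bigl => i; rewrite eq_sym.
have whites : \xor_(i < m) \xor_(j < m | (i < j)%N) h (w (p j)) (w (p i)) =
    odd_perm p (+) \xor_(i < m) \xor_(j < m | (i < j)%N) h (w j) (w i).
  apply: (@xor_tournament_perm m (fun i j => h (w j) (w i))) => i j ij.
  by rewrite hC // (inj_eq w_inj) eq_sym.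
have reind : \xor_(i < m) \xor_(j < m | j != i) t (e i) (w (p j)) =
    \xor_(i < m) \xor_(j < m | j != p i) t (e i) (w j).
  apply: eq_bigr => i _; rewrite [RHS](reindex_inj (@perm_inj _ p)).
  by apply: eq_bigl => j; rewrite (inj_eq perm_inj).
have split2 (F K : 'I_m -> 'I_m -> bool) (P : 'I_m -> pred 'I_m) :
    \xor_(i < m) \xor_(j < m | P i j) (F i j (+) K i j) =
    (\xor_(i < m) \xor_(j < m | P i j) F i j) (+)
    (\xor_(i < m) \xor_(j < m | P i j) K i j).
  by rewrite -big_split; apply: eq_bigr => i _; rewrite big_split.
have solve (A B W X Z : bool) :
    X = A (+) (B (+) W) (+) Z -> B = A (+) W (+) (X (+) Z).
  by move=> ->; case: A; case: B; case: W; case: Z.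
move: lhs; rewrite !(split2 _ _ (fun i j => j != i)) reind.
rewrite !(split2 _ _ (fun i j => (i < j)%N)) in cross *.
rewrite cross whites => /solve ->; congr (_ (+) _).
by rewrite [RHS]big_split /= [X in _ = X (+) _]big_split.
Qed.
End MatchingSign.

Lemma xor_const k (b : bool) (i : 'I_k) :
  \xor_(j < k | j != i) b = odd k.-1 && b.
Proof.
transitivity (\xor_(j < k | j != i) odd b); first by rewrite oddb.
by rewrite -odd_sum sum_nat_const cardC1 card_ord oddM oddb.
Qed.

Lemma xor_increasing_pairs n k (T : Type) (x : 'I_n -> T) (h : rel T)
    (c : bool) (l : 'I_n -> bool) (f : 'I_k -> 'I_n) :
    (forall i j : 'I_n, (i < j)%N -> h (x j) (x i) = c (+) (l i (+) l j)) ->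
    (forall i j : 'I_k, (i < j)%N -> (f i < f j)%N) ->
  \xor_(i < k) \xor_(j < k | (i < j)%N) h (x (f j)) (x (f i)) =
  (\xor_(i < k) \xor_(j < k | (i < j)%N) c) (+)
  \xor_(i < k) (odd k.-1 && l (f i)).
Proof.
move=> hx f_inc.
transitivity (\xor_(i < k) \xor_(j < k | (i < j)%N)
    (c (+) (l (f i) (+) l (f j)))).
  by apply: eq_bigr => i _; apply: eq_bigr => j ij; rewrite hx ?f_inc.
under eq_bigr do rewrite big_split /=.
rewrite big_split /= (xor_pairs (fun i j => l (f i))); congr (_ (+) _).
by apply: eq_bigr => i _; rewrite xor_const.
Qed.

Definition split_col T N k (u : 'I_N -> T) (v : 'I_k -> T)
    (c : 'I_(N + k)) : T :=
  match fintype.split c with inl i => u i | inr j => v j end.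

Lemma xor_split_pairs (T : Type) N k (u : 'I_N -> T) (v : 'I_k -> T)
    (h : rel T) :
  let w := split_col u v in
  \xor_(i < N + k) \xor_(j < N + k | (i < j)%N) h (w j) (w i) =
  (\xor_(i < N) \xor_(j < N | (i < j)%N) h (u j) (u i)) (+)
  (\xor_(i < k) \xor_(j < k | (i < j)%N) h (v j) (v i)) (+)
  \xor_(j < k) \xor_(i < N) h (v j) (u i).
Proof.
move=> w.
have wl i : w (lshift k i) = u i by rewrite /w /split_col (unsplitK (inl i)).
have wr i : w (rshift N i) = v i by rewrite /w /split_col (unsplitK (inr i)).
have row (i : 'I_(N + k)) : \xor_(j < N + k | (i < j)%N) h (w j) (w i) =
    (\xor_(j < N | (i < j)%N) h (u j) (w i)) (+)
    (\xor_(j < k | (i < N + j)%N) h (v j) (w i)).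
  rewrite big_mkcond big_split_ord /= -!big_mkcond /=.
  by congr (_ (+) _); apply: eq_bigr => j _; rewrite ?wl ?wr.
under eq_bigr do rewrite row.
rewrite big_split_ord /= [X in X (+) _]big_split [X in _ (+) X]big_split /=.
rewrite [\xor_(j < k) \xor_(i < N) _]exchange_big /=.
rewrite [\xor_(i < k) \xor_(j < N | _) _]big1 => [|i _]; last first.
  apply: big_pred0 => j /=; apply/negbTE; rewrite -leqNgt.
  by rewrite (leq_trans (ltnW (ltn_ord j))) ?leq_addr.
rewrite addFb -!addbA [_ (+) \xor_(i < N) \xor_(j < k) _]addbC.
congr (_ (+) (_ (+) _)).
- by apply: eq_bigr => i _; apply: eq_bigr => j _; rewrite wl.
- apply: eq_bigr => i _; apply: eq_big => [j|j _]; last by rewrite wl.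
  by rewrite (leq_trans (ltn_ord i)) ?leq_addr.
by apply: eq_bigr => i _; apply: eq_big => [j|j _]; rewrite ?wr //= ltn_add2l.
Qed.

(** * Elimination of columns and labellings of matchings *)

(** Writing P as C (pid_mx r) E with C and E invertible, the columns of P
    become block triangular after multiplication by C^-1, whatever the rank r,
    and the determinant splits as that of pid_mx r times a minor of the last k
    rows of C^-1 Q. If r < N the first factor is 0, and so is the first row of
    L. *)
Lemma det_column_reduction (F : fieldType) (N k n : nat) (c : F)
    (P : 'M[F]_(N + k, N)) (Q : 'M[F]_(N + k, n)) : (0 < k)%N ->
  exists L : 'M[F]_(k, n), forall f : 'I_k -> 'I_n,
    \det (colsub f L) = c * \det (row_mx P (colsub f Q)).
Proof.
case: k P Q => // k P Q _; pose C := col_ebase P; pose E := row_ebase P.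
pose Q' := invmx C *m Q; pose r := \rank P.
pose c' := c * (\det C * (\det (pid_mx r : 'M[F]_N) * \det E)).
(* The scalar is put into the first of the k rows. *)
pose d : 'rV[F]_k.+1 := \row_i (if i == ord0 then c' else 1).
exists (diag_mx d *m dsubmx Q') => f.
have -> : colsub f (diag_mx d *m dsubmx Q') = diag_mx d *m colsub f (dsubmx Q').
  by apply/matrixP => i j; rewrite !mxE; apply: eq_bigr => l _; rewrite !mxE.
rewrite det_mulmx det_diag big_ord_recl mxE eqxx big1 ?mulr1; last first.
  by move=> i _; rewrite mxE.
have -> : row_mx P (colsub f Q) =
    C *m row_mx (pid_mx r) (colsub f Q') *m block_mx E 0 0 1%:M.
  rewrite -mulmxA mul_row_block !mulmx0 !mulmx1 add0r addr0 mul_mx_row mulmxA.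
  rewrite mulmx_ebase; congr row_mx.
  have -> : colsub f Q' = invmx C *m colsub f Q.
    by apply/matrixP => i j; rewrite !mxE; apply: eq_bigr => l _; rewrite !mxE.
  by rewrite mulKVmx // col_ebase_unit.
rewrite !det_mulmx det_ublock det1 mulr1.
have -> : row_mx (pid_mx r : 'M[F]_(N + k.+1, N)) (colsub f Q') =
    block_mx (pid_mx r) (usubmx (colsub f Q')) 0 (dsubmx (colsub f Q')).
  rewrite block_mxEh vsubmxK; congr row_mx; rewrite -[LHS]vsubmxK.
  congr col_mx; apply/matrixP => i j; rewrite !mxE //=.
  by rewrite gtn_eqF // (leq_trans (ltn_ord j)) ?leq_addr.
rewrite det_ublock.
have -> : dsubmx (colsub f Q') = colsub f (dsubmx Q').
  by apply/matrixP => i j; rewrite !mxE.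
rewrite /c'; ring.
Qed.

Section Counting.
Variables (n : nat) (G : bdgraph n) (black : {set vertex G}).
Hypothesis bipG : bipartition black.

Lemma mdegree_le1 (M : {set edge G}) v e f : (mdegree M v <= 1)%N ->
  e \in M -> f \in M -> v \in ends e -> v \in ends f -> e = f.
Proof.
by move=> /card_le1_eqP uniq eM fM ve vf; apply: uniq; rewrite inE ?eM ?fM.
Qed.

Variables (m : nat) (a w : 'I_m -> vertex G) (I : {set vertex G}).
Hypothesis a_inj : injective a.
Hypothesis w_inj : injective w.
Hypothesis blackE : black = [set a i | i : 'I_m].
Hypothesis w_white : forall j, w j \notin black.
Hypothesis w_codom : forall v, v \notin black ->
  (v \in [set w j | j : 'I_m]) = (v \notin boundary G) || (v \in I).
Hypothesis I_bd : I \subset boundary G.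
Hypothesis bd_white : {in boundary G, forall v, v \notin black}.

(** The terms in the expansion of the determinant: a permutation p together
    with, for each row i, an edge joining a i to w (p i). *)
Definition is_labelling (pF : 'S_m * {ffun 'I_m -> edge G}) :=
  [forall i, ends (pF.2 i) == [set a i; w (pF.1 i)]].

Lemma matching_degree (M : {set edge G}) v :
  perfect_matching M -> (mdegree M v <= 1)%N.
Proof. by move=> /forallP/(_ v); case: ifP => // _ /eqP->. Qed.

(** The edges of a labelling form a matching; conversely each black vertex a i
    lies in exactly one edge of a matching, whose white end is some w j, and i
    |-> j is injective since white vertices are covered at most once. *)
Lemma num_matchings_labellings :
  num_matchings I = #|[set pF | is_labelling pF]|.
Proof.
have aw i j : a i != w j.
  by apply: contraNneq (w_white j) => <-; rewrite blackE imset_f.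
pose img (pF : 'S_m * {ffun 'I_m -> edge G}) := [set pF.2 i | i : 'I_m].
have lab_a pF i j : is_labelling pF -> a i \in ends (pF.2 j) -> i = j.
  move=> /forallP/(_ j)/eqP->; rewrite !inE (negbTE (aw _ _)) orbF.
  by move=> /eqP/a_inj.
have lab_w pF i j : is_labelling pF -> w i \in ends (pF.2 j) -> i = pF.1 j.
  move=> /forallP/(_ j)/eqP->; rewrite !inE eq_sym (negbTE (aw _ _)) /=.
  by move=> /eqP/w_inj.
have img_inj : {in [set pF | is_labelling pF] &, injective img}.
  move=> [p F] [q K]; rewrite !inE => pF qK FK.
  have eFK : F = K.
    apply/ffunP => i; have : F i \in img (q, K) by rewrite -FK; apply: imset_f.
    move=> /imsetP[j _ /= Fij]; rewrite Fij; congr (K _); apply/esym.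
    apply: (lab_a _ _ _ qK); rewrite /= -Fij.
    by have /forallP/(_ i)/eqP-> := pF; rewrite set21.
  congr (_, _) => //; apply/permP => i; apply: (lab_w (q, K)) => //=.
  by rewrite -eFK; have /forallP/(_ i)/eqP-> := pF; rewrite set22.
rewrite -(card_in_imset img_inj); apply: eq_card => M; rewrite inE.
apply/andP/imsetP => [[pmM /eqP bdM]|[[p F]]]; last first.
  rewrite inE => pF ->.
  have deg i v : v \in ends (F i) -> mdegree (img (p, F)) v = 1%N.
    move=> vi; rewrite /mdegree -(cards1 (F i)); apply: eq_card => e.
    rewrite !inE; apply/andP/eqP => [[/imsetP[j _ /= ->] vj]|->]; last first.
      by split=> //; apply/imsetP; exists i.
    move: (vi) (vj); have /forallP/(_ i)/eqP-> := pF; rewrite !inE.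
    case/orP => /eqP-> h; congr (F _); last first.
      by apply: (@perm_inj _ p); apply/esym; exact: (lab_w (p, F)).
    by apply/esym; exact: (lab_a (p, F)).
  have in_ends_a i : a i \in ends (F i).
    by have /forallP/(_ i)/eqP-> := pF; rewrite set21.
  have in_ends_w j : w j \in ends (F (p^-1%g j)).
    by have /forallP/(_ (p^-1%g j))/eqP-> := pF; rewrite permKV set22.
  split.
    apply/forallP => v; have [vb|vb] := boolP (v \in black).
      move: (vb); rewrite blackE => /imsetP[i _ ->].
      by rewrite (deg _ _ (in_ends_a i)); case: ifP.
    have [/imsetP[j _ ->]|vw] := boolP (v \in [set w j | j : 'I_m]).
      by rewrite (deg _ _ (in_ends_w j)); case: ifP.
    have := vw; rewrite w_codom // negb_or negbK => /andP[-> _].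
    rewrite /mdegree eq_card0 // => e; rewrite !inE; apply/negbTE/negP.
    move=> /andP[/imsetP[i _ ->] /=]; have /forallP/(_ i)/eqP-> := pF.
    rewrite !inE => /orP[]/eqP ve; move: vb vw; rewrite ve ?imset_f //.
    by rewrite blackE imset_f.
  apply/eqP/setP => v; rewrite inE.
  apply/andP/idP => [[vG /existsP[e /andP[/imsetP[i _ ->] /=]]]|vI].
    have /forallP/(_ i)/eqP-> := pF; rewrite !inE => /orP[]/eqP ve.
      by have := bd_white vG; rewrite ve blackE imset_f.
    have := w_codom (w_white (p i)); rewrite imset_f // -ve vG /=.
    by move=> <-.
  have vG := fintype.subsetP I_bd v vI; split=> //.
  have : v \in [set w j | j : 'I_m] by rewrite w_codom ?vI ?orbT // bd_white.
  move=> /imsetP[j _ ->]; apply/existsP; exists (F (p^-1%g j)).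
  by rewrite in_ends_w andbT; apply/imsetP; exists (p^-1%g j).
have edge_of i : exists e, (e \in M) && (a i \in ends e).
  have ab : a i \in black by rewrite blackE imset_f.
  have aG : a i \notin boundary G by apply: contraL ab => /bd_white.
  have := forallP pmM (a i); rewrite (negbTE aG) => /cards1P[e eE].
  by exists e; have := set11 e; rewrite -eE inE.
pose F := [ffun i => xchoose (edge_of i)].
have FM i : F i \in M by rewrite ffunE; have /andP[] := xchooseP (edge_of i).
have aF i : a i \in ends (F i).
  by rewrite ffunE; have /andP[] := xchooseP (edge_of i).
have wF i : exists j, ends (F i) == [set a i; w j].
  have [b [y [bb yw eby]]] := bipG (F i).
  have ab : a i = b.
    have := aF i; rewrite eby !inE => /orP[]/eqP // ay.
    by move: yw; rewrite -ay blackE imset_f.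
  have : y \in [set w j | j : 'I_m].
    rewrite w_codom //; case: (boolP (y \in boundary G)) => //= yG.
    rewrite -bdM inE yG; apply/existsP; exists (F i).
    by rewrite FM eby set22.
  by move=> /imsetP[j _ yj]; exists j; rewrite eby ab yj.
pose s i := xchoose (wF i).
have sP i : ends (F i) = [set a i; w (s i)] by apply/eqP/(xchooseP (wF i)).
have s_inj : injective s.
  move=> i j sij; apply: a_inj; have := aF i.
  have -> : F i = F j.
    apply: (mdegree_le1 (matching_degree (w (s i)) pmM)) => //.
      by rewrite sP set22.
    by rewrite sP sij set22.
  rewrite sP !inE (negbTE (aw _ _)) orbF; exact/eqP.
exists (perm s_inj, F).
  by rewrite inE; apply/forallP => i /=; rewrite permE sP.
apply/setP => e; apply/idP/imsetP => [eM|[i _ ->] //=].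
have [b [y [bb yw eby]]] := bipG e.
move: bb; rewrite blackE => /imsetP[i _ bi]; exists i => //=.
apply: (mdegree_le1 (matching_degree (a i) pmM)) => //.
by rewrite eby bi set21.
Qed.

End Counting.

(** * The signed biadjacency matrix *)

Lemma ltn_enum_val n (A : {set 'I_n}) (i j : 'I_#|A|) :
  (i < j)%N -> (enum_val i < enum_val j)%N.
Proof.
move=> ij; pose x0 := enum_val i.
rewrite !(enum_val_nth x0) -!(nth_map x0 0%N val) -?cardE //.
have srt : sorted ltn (map val (enum A)).
  rewrite sorted_map /enum_mem -enumT; apply: sorted_filter.
    by move=> ? ? ?; apply: ltn_trans.
  by rewrite -sorted_map val_enum_ord; apply: iota_ltn_sorted.
by apply: (sorted_ltn_nth ltn_trans) => //; rewrite inE size_map -cardE.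
Qed.

Section Kasteleyn.
Variables (R : comNzRingType) (n : nat) (G : bdgraph n).
Variables (black : {set vertex G}) (N k : nat).
Hypothesis bipG : bipartition black.
Hypothesis bd_white : {in boundary G, forall v, v \notin black}.
Variables (t : edge G -> vertex G -> bool) (h : rel (vertex G)).
Variables (c : bool) (l : 'I_n -> bool).
Hypothesis hC : forall x y, x != y -> h y x = ~~ h x y.
Hypothesis t_bd : forall e x, x \in boundary G -> t e x = false.
Hypothesis t_exchange : forall e f a b c d,
  ends e = [set a; b] -> ends f = [set c; d] -> [disjoint ends e & ends f] ->
  (t e c (+) t e d) (+) (t f a (+) t f b) =
  (h c a (+) h d a) (+) (h c b (+) h d b).
Hypothesis h_bd : forall i j : 'I_n, (i < j)%N ->
  h (bdvertex G i) (bdvertex G j) = c (+) (l i (+) l j).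
Variables (a : 'I_(N + k) -> vertex G) (u : 'I_N -> vertex G).
Hypothesis a_inj : injective a.
Hypothesis u_inj : injective u.
Hypothesis blackE : black = [set a i | i : 'I_(N + k)].
Hypothesis internalE : forall v,
  (v \in [set u i | i : 'I_N]) = (v \notin black) && (v \notin boundary G).
Local Notation x := (bdvertex G).

(** The terms of [matching_sign] that belong to an edge e from a i to y. The
    boundary vertices are left out since the turnings around them vanish. *)
Definition edge_parity (e : edge G) (i : 'I_(N + k)) (y : vertex G) : bool :=
  (\xor_(j < N + k | j != i) t e (a j)) (+)
  (\xor_(j < N | u j != y) t e (u j)) (+)
  (h (a i) y (+) \xor_(j < N + k) h (a j) y).

(** The part of the comparisons between white vertices that involves the
    boundary vertex of index j: with the other vertices of I, and with the
    internal ones. *)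
Definition boundary_parity (j : 'I_n) : bool :=
  (odd k.-1 && l j) (+) \xor_(i < N) h (x j) (u i).

Definition common_parity : bool :=
  (\xor_(i < N + k) \xor_(j < N + k | (i < j)%N) (h (a j) (a i) (+) true)) (+)
  (\xor_(i < N) \xor_(j < N | (i < j)%N) h (u j) (u i)) (+)
  \xor_(i < k) \xor_(j < k | (i < j)%N) ~~ c.

Definition internal_columns : 'M[R]_(N + k, N) :=
  \matrix_(i, j) \sum_(e | ends e == [set a i; u j])
    (-1) ^+ edge_parity e i (u j).

Definition boundary_columns : 'M[R]_(N + k, n) :=
  \matrix_(i, j) \sum_(e | ends e == [set a i; x j])
    (-1) ^+ (edge_parity e i (x j) (+) boundary_parity j).

Lemma u_internal i : (u i \notin black) && (u i \notin boundary G).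
Proof. by rewrite -internalE imset_f. Qed.

Lemma x_boundary j : x j \in boundary G.
Proof. exact: imset_f. Qed.

Section Columns.
Variable f : 'I_k -> 'I_n.
Hypothesis f_inc : forall i j : 'I_k, (i < j)%N -> (f i < f j)%N.
Let w := split_col u (fun j => x (f j)).

Lemma f_inj : injective f.
Proof.
move=> i j fij; apply/val_inj; case: (ltngtP i j) => // /f_inc.
  by rewrite fij ltnn.
by rewrite fij ltnn.
Qed.

Lemma columns_lshift i : w (lshift k i) = u i.
Proof. by rewrite /w /split_col (unsplitK (inl i)). Qed.

Lemma columns_rshift i : w (rshift N i) = x (f i).
Proof. by rewrite /w /split_col (unsplitK (inr i)). Qed.

Lemma columns_inj : injective w.
Proof.
move=> i j; case: (split_ordP i) => i' ->; case: (split_ordP j) => j' ->;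
  rewrite ?columns_lshift ?columns_rshift.
- by move/u_inj->.
- by move=> uE; have := u_internal i'; rewrite uE x_boundary andbF.
- by move=> uE; have := u_internal j'; rewrite -uE x_boundary andbF.
- by move/bdvertex_inj/f_inj->.
Qed.

Lemma columns_white j : w j \notin black.
Proof.
case: (split_ordP j) => i ->; rewrite ?columns_lshift ?columns_rshift.
  by have /andP[] := u_internal i.
exact/bd_white/x_boundary.
Qed.

Lemma labelling_sign (p : 'S_(N + k)) (e : 'I_(N + k) -> edge G) :
    (forall i, ends (e i) = [set a i; w (p i)]) ->
  odd_perm p (+) \xor_(i < N + k) (edge_parity (e i) i (w (p i)) (+)
    split_col (fun=> false) (fun j => boundary_parity (f j)) (p i)) =
  common_parity.
Proof.
move=> eE.
have aw i j : a i != w j.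
  by apply: contraNneq (columns_white j) => <-; rewrite blackE imset_f.
have bd_sum : \xor_(i < N + k)
      split_col (fun=> false) (fun j => boundary_parity (f j)) (p i) =
    (\xor_(i < k) (odd k.-1 && l (f i))) (+)
    (\xor_(j < k) \xor_(i < N) h (x (f j)) (u i)).
  transitivity (\xor_(i < N + k)
      split_col (fun=> false) (fun j => boundary_parity (f j)) i).
    by rewrite [RHS](reindex_inj (@perm_inj _ p)).
  rewrite big_split_ord /=.
  rewrite big1 => [|i _]; last by rewrite /split_col (unsplitK (inl i)).
  rewrite addFb -big_split; apply: eq_bigr => i _.
  by rewrite /split_col (unsplitK (inr i)).
have parE i : (\xor_(j < N + k | j != i) t (e i) (a j)) (+)
      (\xor_(j < N + k | j != p i) t (e i) (w j)) (+)
      (h (a i) (w (p i)) (+) \xor_(j < N + k) h (a j) (w (p i))) =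
    edge_parity (e i) i (w (p i)).
  rewrite /edge_parity; congr (_ (+) _ (+) _).
  rewrite big_mkcond big_split_ord /= [X in _ (+) X]big1 => [|j _]; last first.
    by rewrite columns_rshift t_bd ?x_boundary // if_same.
  rewrite addbF [RHS]big_mkcond; apply: eq_bigr => j _.
  by rewrite -columns_lshift (inj_eq columns_inj).
rewrite big_split /= bd_sum.
rewrite (matching_sign hC t_exchange a_inj columns_inj aw eE).
under [X in _ (+) X (+) _ = _]eq_bigr do rewrite parE.
rewrite xor_split_pairs.
rewrite (@xor_increasing_pairs n k _ x h (~~ c) l f) //; last first.
  move=> i j ij; rewrite hC ?h_bd ?addNb //.
  by rewrite (inj_eq (@bdvertex_inj _ G)) -val_eqE /= ltn_eqF.
have cancel (A B C S S' X : bool) :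
    A (+) (B (+) (C (+) S) (+) S') (+) X (+) (X (+) (S (+) S')) =
    A (+) B (+) C.
  by case: A; case: B; case: C; case: S; case: S'; case: X.
exact: cancel.
Qed.

Lemma det_columns : \det (row_mx internal_columns (colsub f boundary_columns)) =
  (-1) ^+ common_parity *
  (num_matchings [set x (f j) | j : 'I_k])%:R.
Proof.
rewrite (@num_matchings_labellings _ G black bipG _ a w) //; first last.
- by apply/fintype.subsetP => v /imsetP[j _ ->]; apply: x_boundary.
- move=> v vb; apply/imsetP/orP => [[j _ ->]|].
    case: (split_ordP j) => i ->; rewrite ?columns_lshift ?columns_rshift.
      by left; have /andP[] := u_internal i.
    by right; apply/imsetP; exists i.
  case=> [vG|/imsetP[j _ ->]].
    have : v \in [set u i | i : 'I_N] by rewrite internalE vb.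
    by move=> /imsetP[i _ ->]; exists (lshift k i); rewrite ?columns_lshift.
  by exists (rshift N j); rewrite ?columns_rshift.
- exact: columns_white.
- exact: columns_inj.
pose s (e : edge G) i j : R := (-1) ^+ (edge_parity e i (w j) (+)
  split_col (fun=> false) (fun j => boundary_parity (f j)) j).
have entry i j : row_mx internal_columns (colsub f boundary_columns) i j =
    \sum_(e | ends e == [set a i; w j]) s e i j.
  rewrite /s; case: (split_ordP j) => j' ->.
    rewrite row_mxEl mxE columns_lshift; apply: eq_bigr => e _.
    by rewrite /split_col (unsplitK (inl j')) addbF.
  rewrite row_mxEr !mxE columns_rshift; apply: eq_bigr => e _.
  by rewrite /split_col (unsplitK (inr j')).
rewrite /determinant -sum1_card natr_sum mulr_sumr.
rewrite (eq_bigl (fun pF : 'S_(N + k) * {ffun 'I_(N + k) -> edge G} =>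
    true && (pF.2 \in family (fun i e =>
      ends e == [set a i; w (pF.1 i)])))); last by move=> pF; rewrite inE.
rewrite -(pair_big_dep xpredT
    (fun (p : 'S_(N + k)) (F : {ffun 'I_(N + k) -> edge G}) =>
    F \in family (fun i e => ends e == [set a i; w (p i)]))
    (fun p F => (-1) ^+ common_parity * 1%:R)) /=.
apply: eq_bigr => p _.
under eq_bigr do rewrite entry.
rewrite bigA_distr_big_dep mulr_sumr; apply: eq_bigr => F /familyP FE.
rewrite mulr1 -(labelling_sign (p := p) (e := F)); last first.
  by move=> i; apply/eqP/FE.
by rewrite signr_addb (big_morph _ (@signr_addb R) (erefl _)).
Qed.

End Columns.
End Kasteleyn.

Theorem theorem3 (R : realType) (N k n : nat) (k_gt0 : (0 < k)%N)
    (G : bdgraph n) (D : disc_embedding R G)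
    (black : {set vertex G}) (bipG : bipartition black)
    (bd_white : {in boundary G, forall v, v \notin black})
    (card_black : #|black| = (N + k)%N)
    (card_internal_white :
      #|[pred v | (v \notin black) && (v \notin boundary G)]| = N) :
  exists L : 'M[R]_(k, n),
    forall (I : {set vertex G}) (sI : I \subset boundary G) (cI : #|I| = k),
      (num_matchings I)%:R = \det (column_submx L sI cI).
Proof.
have [t [h [c [l [hC t_bd t_exch h_bd]]]]] := planar_sign_data D.
pose a i := enum_val (cast_ord (esym card_black) i).
pose u i := enum_val (cast_ord (esym card_internal_white) i).
have a_inj : injective a by move=> i j /enum_val_inj/cast_ord_inj.
have u_inj : injective u by move=> i j /enum_val_inj/cast_ord_inj.
have blackE : black = [set a i | i : 'I_(N + k)].
  apply/setP => v; apply/idP/imsetP => [vb|[i _ ->]]; last exact: enum_valP.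
  exists (cast_ord card_black (enum_rank_in vb v)) => //.
  by rewrite /a cast_ordK enum_rankK_in.
have internalE v : (v \in [set u i | i : 'I_N]) =
    (v \notin black) && (v \notin boundary G).
  apply/imsetP/idP => [[i _ ->]|vI].
    by have := enum_valP (cast_ord (esym card_internal_white) i).
  have vI' : v \in [pred v | (v \notin black) && (v \notin boundary G)] by [].
  exists (cast_ord card_internal_white (enum_rank_in vI' v)) => //.
  by rewrite /u cast_ordK enum_rankK_in.
have [L LE] := det_column_reduction ((-1) ^+ common_parity h c a u)
  (internal_columns R t h a u) (boundary_columns R t h l a u) k_gt0.
exists L => I sI cI.
pose card_I := etrans (card_bdindices sI) cI.
pose f j : 'I_n := enum_val (cast_ord (esym card_I) j).
have f_inc (i j : 'I_k) : (i < j)%N -> (f i < f j)%N.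
  by move=> ij; apply: ltn_enum_val.
rewrite -[column_submx _ _ _]/(colsub f L) LE.
rewrite (det_columns R bipG bd_white hC t_bd t_exch h_bd a_inj u_inj blackE
  internalE f_inc).
rewrite mulrA -signr_addb addbb mul1r; congr (num_matchings _)%:R.
apply/setP => v; apply/idP/imsetP => [vI|[j _ ->]]; last first.
  by have := enum_valP (cast_ord (esym card_I) j); rewrite inE.
have /imsetP[i _ vi] := fintype.subsetP sI v vI.
have iI : i \in bdindices I by rewrite inE -vi.
exists (cast_ord card_I (enum_rank_in iI i)) => //.
by rewrite /f cast_ordK enum_rankK_in.
Qed.
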